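(* Consider the Global Flux (GF) Galerkin semi-discretization $$ \begin{cases} M_x\otimes M_y\,\partial_t \mathrm u + D_x\otimes M_y\,\bigl(\mathrm p-\mathrm K_u\bigr)=0,\\ M_x\otimes M_y\,\partial_t \mathrm v + M_x\otimes D_y\,\bigl(\mathrm p-\mathrm K_v\bigr)=0,\\ M_x\otimes M_y\,\partial_t \mathrm p + D_x\otimes D_y\,\bigl(\mathrm U+\mathrm V-\mathrm K_p\bigr)=0, \end{cases} $$ with $\mathrm U=\mathbf 1_x\otimes I_y\,\mathrm u$, $\mathrm V=I_x\otimes \mathbf 1_y\,\mathrm v$, $\mathrm K_u=I_x\otimes\mathbf 1_y\,\mathrm S_u$, $\mathrm K_v=\mathbf 1_x\otimes I_y\,\mathrm S_v$, $\mathrm K_p=I_x\otimes I_y\,\mathrm S_p$ (all notation as in the context). This scheme admits the discrete steady states characterized by $$ \begin{aligned} \mathrm p_{i,k;j,s}-(\mathrm K_u)_{i,k;j,s}&=\sigma^y_u(j,s),\\ \mathrm p_{i,k;j,s}-(\mathrm K_v)_{i,k;j,s}&=\sigma^x_v(i,k),\\ \mathrm U_{i,k;j,s}+\mathrm V_{i,k;j,s}-(\mathrm K_p)_{i,k;j,s}&=\sigma^x_p(i,k)+\sigma^y_p(j,s) \end{aligned} $$ at all nodes $(i,k;j,s)$, where $\sigma^y_u,\sigma^y_p$ are arbitrary functions of the $y$-node $(j,s)$ only and $\sigma^x_v,\sigma^x_p$ are arbitrary functions of the $x$-node $(i,k)$ only. That is, whenever nodal arrays $(\mathrm u,\mathrm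 v,\mathrm p)$ satisfy these relations for some such functions, the spatial (time-derivative-free) part of each of the three equations vanishes.
   Context: PDE. The scheme approximates $\partial_t u+\partial_x p=S_u$, $\partial_t v+\partial_y p=S_v$, $\partial_t p+\partial_x u+\partial_y v=S_p$ on a rectangle $\Omega=[x_0,x_e]\times[y_0,y_e]$. The velocity source is $(S_u,S_v)=c(x,y)(v,-u)-f(x,y)(u,v)+\boldsymbol\tau(x,y)$ with given functions $c,f,\boldsymbol\tau$, and $S_p$ is a scalar source. Mesh and spaces. $\Omega$ is divided into uniform Cartesian cells $E_{ij}=[x_i,x_{i+1}]\times[y_j,y_{j+1}]$, $0\le i<N_x$, $0\le j<N_y$. Fix a degree $K\ge 1$. Each cell $[x_i,x_{i+1}]$ carries the $K+1$ Gauss-Lobatto points $x_{i,0}=x_i<\dots<x_{i,K}=x_{i+1}$ (so the nodes $(i,0)$ and $(i-1,K)$ are identified), and similarly $y_{j,0},\dots,y_{j,K}$. Let $\varphi^x_\alpha$ be the continuous piecewise-$\mathbb P^K$ Lagrange basis at the 1D nodes $\alpha=(i,p)$ in $x$, and $\varphi^y_\beta$ the one in $y$. $V_h$ is the space spanned by the products $\varphi^x_\alpha(x)\varphi^y_\beta(y)$. A function $q_h\in V_h$ is identified with its array $\mathrm q=(\mathrm q_{\alpha;\beta})$ of nodal values, and $(A\otimes B)\mathrm q$ has entries $\sum_{\alpha',\beta'}A_{\alpha\alpha'}B_{\beta\beta'}\mathrm q_{\alpha';\beta'}$. Matrices. $(M_x)_{\alpha\beta}=\int\varphi^x_\alpha\varphi^x_\beta\,dx$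 and $(D_x)_{\alpha\beta}=\int\varphi^x_\alpha\,(\varphi^x_\beta)'\,dx$, with integrals computed by Gauss-Lobatto quadrature at the nodes (so the mass matrix $M_x$ is diagonal); $M_y,D_y$ are defined analogously in $y$. $\mathbf 1_x,\mathbf 1_y$ are identity matrices. Integration operators. For a 1D nodal array $\mathrm q$ with interpolant $q_h$, $(I_x\mathrm q)_{i,p}=(I_x\mathrm q)_{i,0}+\int_{x_{i,0}}^{x_{i,p}}q_h(x)\,dx$, with continuity $(I_x\mathrm q)_{i,0}=(I_x\mathrm q)_{i-1,K}$ across cells and initial value $0$ at $x_0$; $I_y$ is analogous. Sources and boundary. $\mathrm S_u,\mathrm S_v,\mathrm S_p$ are the arrays of nodal values of the sources (evaluated at the nodal unknowns where they depend on them). The variational equations are tested with functions of $V_h$ vanishing on $\partial\Omega$ and are complemented by boundary conditions. A discrete steady state is a state $(\mathrm u,\mathrm v,\mathrm p)$ for which the spatial part of the equations vanishes. *)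

(* Defs.v *)
From HB Require Import structures.
From mathcomp Require Import all_boot all_order all_algebra.
From mathcomp Require Import all_classical all_reals all_analysis.
Set Implicit Arguments.
Unset Strict Implicit.
Unset Printing Implicit Defensive.
Import Order.TTheory GRing.Theory Num.Theory.
Import numFieldNormedType.Exports.
Local Open Scope ring_scope.

Definition legendre (R : realType) (n : nat) : {poly R} :=
  (2 ^+ n * n`!%:R)^-1 *: (('X^2 - 1) ^+ n)^`(n).

Definition gauss_lobatto (R : realType) (K : nat) (xi : 'I_K.+1 -> R) : Prop :=
  [/\ {homo xi : p q / (p < q)%N >-> p < q},
      xi ord0 = -1, xi ord_max = 1 &
      forall p : 'I_K.+1, (0 < p < K)%N -> root (legendre R K)^`() (xi p)].

Record grid (R : realType) (K : nat) := Grid {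
  lo : R;
  hi : R;
  ncells : nat;
  xi : 'I_K.+1 -> R;
  lo_lt_hi : lo < hi;
  ncells_gt0 : (0 < ncells)%N;
  xi_gauss_lobatto : gauss_lobatto xi }.

(* The local node (i, p), with i < ncells and p <= K, is the global node
   i * K + p, so that (i, 0) and (i.-1, K) are the same node. *)
Notation nnode g K := (ncells g * K).+1.

Section Grid.
Variables (R : realType) (K : nat) (g : grid R K).
Local Notation mu := (@lebesgue_measure R).

Definition cellsize : R := (hi g - lo g) / (ncells g)%:R.

Definition vertex (i : nat) : R := lo g + cellsize * i%:R.

Definition node (i : nat) (p : 'I_K.+1) : R :=
  vertex i + cellsize * ((xi g p + 1) / 2).

Definition nodept (a : 'I_(nnode g K)) : R := node (a %/ K) (inord (a %% K)).

Definition cell_lagrange (i : nat) (p : 'I_K.+1) : {poly R} :=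
  \prod_(q < K.+1 | q != p) ((node i p - node i q)^-1 *: ('X - (node i q)%:P)).

(* The polynomial that coincides on cell i with the continuous piecewise
   polynomial basis function of the global node a; it is 0 if a is not a node
   of cell i. *)
Definition basis (a : 'I_(nnode g K)) (i : nat) : {poly R} :=
  \sum_(p < K.+1 | (i * K + p)%N == a) cell_lagrange i p.

Definition weight (i : nat) (p : 'I_K.+1) : R :=
  \int[mu]_(x in `[vertex i, vertex i.+1]) (cell_lagrange i p).[x].

(* The integrand is given cell by cell because the derivatives of the basis
   functions jump across the vertices. *)
Definition quadrature (f : nat -> {poly R}) : R :=
  \sum_(i < ncells g) \sum_(p < K.+1) weight i p * (f i).[node i p].

Definition massmx : 'M[R]_(nnode g K) :=
  \matrix_(a, b) quadrature (fun i => basis a i * basis b i).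

Definition derivmx : 'M[R]_(nnode g K) :=
  \matrix_(a, b) quadrature (fun i => basis a i * (basis b i)^`()).

Definition interpolant (q : 'I_(nnode g K) -> R) (i : nat) : {poly R} :=
  \sum_a q a *: basis a i.

(* (I q)_{i,0}, where (I q)_{i.+1,0} = (I q)_{i,K}. *)
Fixpoint integ_vertex (q : 'I_(nnode g K) -> R) (i : nat) : R :=
  if i is j.+1 then
    integ_vertex q j +
    \int[mu]_(x in `[node j ord0, node j ord_max]) (interpolant q j).[x]
  else 0.

Definition integ (q : 'I_(nnode g K) -> R) (a : 'I_(nnode g K)) : R :=
  let i := (a %/ K)%N in
  integ_vertex q i +
  \int[mu]_(x in `[node i ord0, node i (inord (a %% K))]) (interpolant q i).[x].

Definition integmx : 'M[R]_(nnode g K) :=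
  \matrix_(a, b) integ (fun d => (d == b)%:R) a.

End Grid.

Section GlobalFlux.
Variables (R : realType) (K : nat) (X Y : grid R K).
Local Notation field := 'M[R]_(nnode X K, nnode Y K).

Definition tensor_act (A : 'M[R]_(nnode X K)) (B : 'M[R]_(nnode Y K))
    (q : field) : field :=
  \matrix_(a, b) \sum_a' \sum_b' A a a' * B b b' * q a' b'.

Variables (c f : R -> R -> R) (tau : R -> R -> R * R).
(* arguments x, y, u, v, p *)
Variable s : R -> R -> R -> R -> R -> R.
Variables u v p : field.

Definition source_u : field := \matrix_(a, b)
  (c (nodept a) (nodept b) * v a b - f (nodept a) (nodept b) * u a b
   + (tau (nodept a) (nodept b)).1).

Definition source_v : field := \matrix_(a, b)
  (- (c (nodept a) (nodept b) * u a b) - f (nodept a) (nodept b) * v a b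
   + (tau (nodept a) (nodept b)).2).

Definition source_p : field := \matrix_(a, b)
  s (nodept a) (nodept b) (u a b) (v a b) (p a b).

Definition gf_U : field := tensor_act 1%:M (integmx Y) u.
Definition gf_V : field := tensor_act (integmx X) 1%:M v.
Definition gf_Ku : field := tensor_act (integmx X) 1%:M source_u.
Definition gf_Kv : field := tensor_act 1%:M (integmx Y) source_v.
Definition gf_Kp : field := tensor_act (integmx X) (integmx Y) source_p.

Definition gf_space_u : field :=
  tensor_act (derivmx X) (massmx Y) (p - gf_Ku).
Definition gf_space_v : field :=
  tensor_act (massmx X) (derivmx Y) (p - gf_Kv).
Definition gf_space_p : field :=
  tensor_act (derivmx X) (derivmx Y) (gf_U + gf_V - gf_Kp).

(* The equations hold on all rows, hence also on the rows of the interior nodes,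
   which are those tested when the test functions vanish on the boundary. *)
Definition gf_steady_state : Prop :=
  [/\ gf_space_u = 0, gf_space_v = 0 & gf_space_p = 0].

End GlobalFlux.

Section GridTheory.
Variables (R : realType) (K : nat) (g : grid R K).
Hypothesis K_gt0 : (0 < K)%N.
Local Notation mu := (@lebesgue_measure R).

Lemma node0 i : node g i ord0 = vertex g i.
Proof.
by case: (xi_gauss_lobatto g) => _ e _ _; rewrite /node e addNr mul0r mulr0 addr0.
Qed.

Lemma nodeK i : node g i ord_max = vertex g i.+1.
Proof.
case: (xi_gauss_lobatto g) => _ _ e _; rewrite /node e -[1 + 1]/(2%:R).
by rewrite divff ?pnatr_eq0 // /vertex -addrA -mulrDr natr1.
Qed.

Lemma cellsize_gt0 : 0 < cellsize g.
Proof.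
by rewrite divr_gt0 ?subr_gt0 ?lo_lt_hi // ltr0n ncells_gt0.
Qed.

Lemma node_inj i : injective (node g i).
Proof.
move=> p q /addrI /(mulfI (lt0r_neq0 cellsize_gt0)).
move=> /(mulIf (invr_neq0 (lt0r_neq0 (ltr0n _ 2)))) /addIr e.
case: (xi_gauss_lobatto g) => h _ _ _; apply/val_inj/eqP.
by case: ltngtP => // /h; rewrite e ltxx.
Qed.

Lemma nodept_node (a : 'I_(nnode g K)) i (p : 'I_K.+1) :
  a = (i * K + p)%N :> nat -> nodept a = node g i p.
Proof.
move=> e; rewrite /nodept e.
have := ltn_ord p; rewrite ltnS leq_eqVlt => /orP[/eqP pK|ltpK].
  have -> : (i * K + p = i.+1 * K)%N by rewrite pK mulSn addnC.
  rewrite mulnK // modnMl (_ : inord 0 = ord0); last exact/val_inj/inordK.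
  by rewrite node0 -nodeK; congr node; apply/val_inj.
by rewrite divnMDl // divn_small // addn0 modnMDl modn_small // inord_val.
Qed.

Lemma cell_lagrange_node i (p q : 'I_K.+1) : (cell_lagrange g i p).[node g i q] = (p == q)%:R.
Proof.
rewrite horner_prod; have [<-|ne] := eqVneq p q.
  rewrite big1 // => r rp; rewrite hornerZ hornerXsubC mulVf //.
  by rewrite subr_eq0; apply: contraNneq rp => /node_inj ->.
rewrite (bigD1 q) /= 1?eq_sym //.
by rewrite hornerZ hornerXsubC subrr mulr0 mul0r.
Qed.

Lemma basis_node (a : 'I_(nnode g K)) i (p : 'I_K.+1) :
  (basis a i).[node g i p] = ((i * K + p)%N == a)%:R.
Proof.
rewrite horner_sum (eq_bigr _ (fun q _ => cell_lagrange_node i q p)).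
rewrite big_mkcond (bigD1 p) //= eqxx big1 ?addr0; first by case: eqP.
by move=> q /negPf ->; case: ifP.
Qed.

Lemma integ_lo (q : 'I_(nnode g K) -> R) : integ q ord0 = 0.
Proof.
rewrite /integ /= div0n mod0n /= add0r (_ : inord 0 = ord0).
  by rewrite set_itv1 Rintegral_set1.
exact/val_inj/inordK.
Qed.

Lemma integ_node (q : 'I_(nnode g K) -> R) (a b : 'I_(nnode g K)) i
    (p : 'I_K.+1) :
  a = (i * K)%N :> nat -> b = (i * K + p)%N :> nat ->
  integ q b = integ q a +
    \int[mu]_(x in `[node g i ord0, node g i p]) (interpolant q i).[x].
Proof.
have i0 : inord 0 = ord0 :> 'I_K.+1 by exact/val_inj/inordK.
have vE j : integ_vertex q j +
    \int[mu]_(x in `[node g j ord0, node g j ord0]) (interpolant q j).[x]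
    = integ_vertex q j by rewrite set_itv1 Rintegral_set1 addr0.
move=> ea eb; have da : (a %/ K = i)%N by rewrite ea mulnK.
have ma : (a %% K = 0)%N by rewrite ea modnMl.
rewrite /integ da ma i0 vE.
have := ltn_ord p; rewrite ltnS leq_eqVlt => /orP[/eqP pK|ltpK].
  have iK : (i * K + p = i.+1 * K)%N by rewrite pK mulSn addnC.
  have db : (b %/ K = i.+1)%N by rewrite eb iK mulnK.
  have mb : (b %% K = 0)%N by rewrite eb iK modnMl.
  rewrite db mb i0 vE; have -> : p = ord_max by exact/val_inj.
  reflexivity.
have db : (b %/ K = i)%N by rewrite eb divnMDl // divn_small // addn0.
have mb : (b %% K = p)%N by rewrite eb modnMDl modn_small.
by rewrite db mb inord_val; reflexivity.
Qed.

Let hint (h : {poly R}) (a b : R) :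
  mu.-integrable `[a, b]%classic (EFin \o horner h).
Proof.
apply: continuous_compact_integrable; first exact: segment_compact.
apply: continuous_subspaceT => x; exact: continuous_horner.
Qed.

Let int_sum n (h : 'I_n -> {poly R}) (q : 'I_n -> R) (a b : R) :
  \int[mu]_(x in `[a, b]) (\sum_d q d *: h d).[x] =
  \sum_d q d * \int[mu]_(x in `[a, b]) (h d).[x].
Proof.
elim: n h q => [|n IH] h q.
  rewrite !big_ord0 /Rintegral integral0_eq // => x _.
  by rewrite horner0.
rewrite !big_ord_recl -IH -RintegralZl // -RintegralD //.
  by apply: eq_Rintegral => x _; rewrite hornerD hornerZ.
rewrite (_ : _ \o _ = EFin \o horner (q ord0 *: h ord0)); first exact: hint.
by apply/funext => x /=; rewrite hornerZ.
Qed.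

Lemma integmxE (q : 'I_(nnode g K) -> R) a :
  \sum_b integmx g a b * q b = integ q a.
Proof.
have deltaE b i : interpolant (fun d => (d == b)%:R) i = basis b i :> {poly R}.
  rewrite /interpolant (bigD1 b) //= eqxx scale1r big1 ?addr0 // => d /negPf ->.
  by rewrite scale0r.
have vertexE i : integ_vertex q i =
    \sum_b integ_vertex (fun d => (d == b)%:R) i * q b.
  elim: i => [|i IH] /=; first by rewrite big1 // => b _; rewrite mul0r.
  rewrite IH int_sum -big_split; apply: eq_bigr => b _ /=.
  by rewrite deltaE mulrDl [X in _ + X]mulrC.
rewrite /integ vertexE int_sum -big_split; apply: eq_bigr => b _ /=.
by rewrite mxE /integ deltaE mulrDl [X in _ + X]mulrC.
Qed.

End GridTheory.

(* Main.v *)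
Require Import Defs.
From mathcomp Require Import all_boot all_order all_algebra.
From mathcomp Require Import all_classical all_reals all_analysis.
Import GRing.Theory.
Local Open Scope ring_scope.

(** Every row of the derivative matrix sums to zero: its row sums are the
    quadrature of a basis function against the derivative of the sum of all
    basis functions, and on each cell this sum is the constant 1
    ([sum_basis]), because the Lagrange polynomials at K + 1 points interpolate
    constants exactly. Hence [D_x \otimes B] kills every array that depends on
    the y-node only and [A \otimes D_y] every array that depends on the x-node
    only. The flux p - K_u of the first equation is of the first kind, the flux
    p - K_v of the second equation of the second kind, and the flux of the third
    equation is a sum of one array of each kind, both killed by
    [D_x \otimes D_y]. *)

Section PartitionOfUnity.
Variables (R : realType) (K : nat) (g : grid R K).

Lemma size_cell_lagrange i (p : 'I_K.+1) : (size (cell_lagrange g i p) <= K.+1)%N.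
Proof.
have card_neq : #|[pred q : 'I_K.+1 | q != p]| = K by rewrite (cardC1 p) card_ord.
apply: leq_trans (size_poly_prod_leq _ _) _.
rewrite card_neq leq_subLR addnS ltnS.
(* Each of the K factors has size at most 2. *)
apply: (@leq_trans (\sum_(q < K.+1 | q != p) 2)%N).
  apply: leq_sum => q _; apply: leq_trans (size_scale_leq _ _) _.
  by rewrite size_XsubC.
by rewrite sum_nat_const card_neq muln2 -addnn.
Qed.

(** The difference of the two sides has size at most K + 1 and vanishes at the
    K + 1 distinct nodes of the cell. *)
Lemma sum_cell_lagrange i : \sum_p cell_lagrange g i p = 1.
Proof.
apply/eqP; rewrite -subr_eq0; apply/eqP.
apply: (@roots_geq_poly_eq0 _ _ [seq node g i q | q <- enum 'I_K.+1]).
- apply/allP => _ /mapP[q _ ->]; apply/rootP.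
  rewrite hornerD hornerN hornerC horner_sum.
  rewrite (eq_bigr _ (fun p _ => cell_lagrange_node g i p q)).
  by rewrite (bigD1 q) //= eqxx big1 ?addr0 ?subrr // => p /negPf ->.
- by rewrite map_inj_uniq ?enum_uniq //; apply: node_inj.
- rewrite size_map size_enum_ord.
  apply: (leq_trans (size_polyD _ _)); rewrite geq_max size_polyN size_poly1 andbT.
  apply: (leq_trans (size_sum _ _ _)); apply/bigmax_leqP => p _.
  exact: size_cell_lagrange.
Qed.

(** On a cell of the grid, each local node carries exactly one global basis
    function, so the basis functions add up to the sum of the local Lagrange
    polynomials. *)
Lemma sum_basis i : (i < ncells g)%N ->
  \sum_(a < nnode g K) Defs.basis a i = 1 :> {poly R}.
Proof.
move=> lt_i; rewrite -(sum_cell_lagrange i).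
rewrite /Defs.basis (exchange_big_dep predT) //=; apply: eq_bigr => p _.
(* Local node p of cell i is the global node i * K + p and no other. *)
have lt_ip : (i * K + p < nnode g K)%N.
  rewrite ltnS (@leq_trans (i.+1 * K)) ?leq_mul2r ?lt_i ?orbT //.
  by rewrite mulSn addnC leq_add2r -ltnS.
by rewrite (big_pred1 (Ordinal lt_ip)) // => a; rewrite /= eq_sym.
Qed.

(** The quadrature is linear in its integrand, so the row sum is the quadrature
    against the derivative of the constant 1. *)
Lemma sum_derivmx a : \sum_b derivmx g a b = 0.
Proof.
under eq_bigr => b _ do rewrite mxE /quadrature.
rewrite exchange_big big1 //= => i _.
rewrite exchange_big big1 //= => p _.
rewrite -mulr_sumr -horner_sum -mulr_sumr -raddf_sum sum_basis //.
by rewrite /= derivC mulr0 horner0 mulr0.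
Qed.

End PartitionOfUnity.

Section TensorAct.
Variables (R : realType) (K : nat) (X Y : grid R K).
Local Notation field := 'M[R]_(nnode X K, nnode Y K).

Lemma tensor_actD A B (q r : field) :
  tensor_act A B (q + r) = tensor_act A B q + tensor_act A B r.
Proof.
apply/matrixP => a b; rewrite !mxE -big_split; apply: eq_bigr => a' _ /=.
by rewrite -big_split; apply: eq_bigr => b' _; rewrite mxE mulrDr.
Qed.

Lemma tensor_act_derivx B (sigma : 'I_(nnode Y K) -> R) :
  tensor_act (derivmx X) B (\matrix_(a, b) sigma b : field) = 0.
Proof.
apply/matrixP => a b; rewrite !mxE exchange_big big1 //= => b' _.
under eq_bigr => a' _ do rewrite mxE -mulrA.
by rewrite -mulr_suml sum_derivmx mul0r.
Qed.

Lemma tensor_act_derivy A (sigma : 'I_(nnode X K) -> R) :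
  tensor_act A (derivmx Y) (\matrix_(a, b) sigma a : field) = 0.
Proof.
apply/matrixP => a b; rewrite !mxE big1 //= => a' _.
under eq_bigr => b' _ do rewrite mxE mulrAC.
by rewrite -mulr_sumr sum_derivmx mulr0.
Qed.

End TensorAct.

Theorem proposition5 (R : realType) (K : nat) (hK : (1 <= K)%N)
    (X Y : grid R K)
    (c f : R -> R -> R) (tau : R -> R -> R * R)
    (s : R -> R -> R -> R -> R -> R)
    (u v p : 'M[R]_(nnode X K, nnode Y K)) :
  (exists (sigma_yu sigma_yp : 'I_(nnode Y K) -> R)
          (sigma_xv sigma_xp : 'I_(nnode X K) -> R),
     forall (a : 'I_(nnode X K)) (b : 'I_(nnode Y K)),
       [/\ p a b - gf_Ku c f tau u v a b = sigma_yu b,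
           p a b - gf_Kv c f tau u v a b = sigma_xv a &
           gf_U u a b + gf_V v a b - gf_Kp s u v p a b
             = sigma_xp a + sigma_yp b]) ->
  gf_steady_state c f tau s u v p.
Proof.
move=> [su [sp [tv [tp H]]]]; split.
- rewrite /gf_space_u -[RHS](tensor_act_derivx _ _ _ _ (massmx Y) su).
  congr tensor_act; apply/matrixP => a b; have [Hu _ _] := H a b.
  by rewrite [RHS]mxE -Hu !mxE.
- rewrite /gf_space_v -[RHS](tensor_act_derivy _ _ _ _ (massmx X) tv).
  congr tensor_act; apply/matrixP => a b; have [_ Hv _] := H a b.
  by rewrite [RHS]mxE -Hv !mxE.
- have fluxE : gf_U u + gf_V v - gf_Kp s u v p =
      \matrix_(a, b) tp a + \matrix_(a, b) sp b.
    apply/matrixP => a b; have [_ _ Hab] := H a b.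
    by rewrite [RHS]mxE [X in _ = X + _]mxE [X in _ = _ + X]mxE -Hab !mxE.
  by rewrite /gf_space_p fluxE tensor_actD tensor_act_derivx tensor_act_derivy addr0.
Qed.
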